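(* Let $d\ge1$, $n\ge 1$, and let $\vec v_1,\ldots,\vec v_n\in\mathbb{Z}^d$ be primitive vectors. Let $m$ be an integer such that $p=m-1$ is a prime with $p\ge 2n+1$. Then in the Maker-Breaker game played on $\mathbb{Z}^d$ where Maker needs to put at least $m$ of his marks consecutively in one of the directions $\vec v_1,\ldots,\vec v_n$, Breaker can force a draw using a pairing strategy; that is, there exists a collection of pairwise disjoint two-element subsets of $\mathbb{Z}^d$ such that every set $\{\vec a,\vec a+\vec v_i,\ldots,\vec a+(m-1)\vec v_i\}$ (with $\vec a\in\mathbb{Z}^d$, $i\in\{1,\ldots,n\}$) contains both elements of at least one of these pairs.
   Context: A vector $(w_1,\ldots,w_d)\in\mathbb{Z}^d$ is primitive if $\gcd(w_1,\ldots,w_d)=1$. In the Maker-Breaker game, Maker and Breaker alternately occupy points of $\mathbb{Z}^d$ (Maker first); Maker wins if he occupies a winning set, i.e. $m$ consecutive points $\{\vec a+k\vec v_i:0\le k\le m-1\}$ in one of the given directions, otherwise the game is a draw. A pairing strategy is a matching of points such that every winning set contains a matched pair; Breaker answers each Maker move by taking the matched point. *)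

(* Defs.v *)
From mathcomp Require Import all_boot all_order all_algebra finmap.

Set Implicit Arguments.
Unset Strict Implicit.
Unset Printing Implicit Defensive.

Import GRing.Theory.
Local Open Scope fset_scope.
Local Open Scope ring_scope.

Notation point d := 'rV[int]_d.

(* The empty gcd is 0, so no vector of dimension 0 is primitive. *)
Definition primitive (d : nat) (w : point d) : Prop :=
  \big[gcdz/0]_(j < d) w 0 j = 1.

Definition line (d m : nat) (a v : point d) : {fset point d} :=
  [fset a + v *+ (k : 'I_m) | k in 'I_m].

Definition winning_set (d n m : nat) (v : 'I_n -> point d)
    (L : {fset point d}) : Prop :=
  exists (a : point d) (i : 'I_n), L = line m a (v i).

Section Game.

Variable T : choiceType.

(* A matching may be infinite and need not cover every point. *)
Definition matching (M : {fset T} -> Prop) : Prop :=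
  (forall e, M e -> #|` e| = 2%N) /\
  (forall e f, M e -> M f -> e <> f -> [disjoint e & f]).

Definition blocks (M : {fset T} -> Prop) (W : {fset T} -> Prop) : Prop :=
  forall L, W L -> exists2 e, M e & e `<=` L.

(* A strategy maps the points taken so far by Maker (in order, including the
   move to be answered, which is the last one) and those taken so far by
   Breaker to Breaker's next point. *)
Definition strategy := seq T -> seq T -> T.

Definition legal_strategy (s : strategy) : Prop :=
  forall A B, s A B \notin A ++ B.

(* When Maker's last point is unmatched, or its partner is already taken,
   Breaker may occupy any free point. *)
Definition plays_pairing (M : {fset T} -> Prop) (s : strategy) : Prop :=
  forall A B x y, x != y -> M [fset x; y] -> y \notin rcons A x ++ B ->
    s (rcons A x) B = y.

(* [mk t] and [br t] are the points taken by Maker and by Breaker in round t,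
   Maker moving first. *)
Definition play_against (s : strategy) (mk br : nat -> T) : Prop :=
  forall t, mk t \notin mkseq mk t ++ mkseq br t /\
            br t = s (mkseq mk t.+1) (mkseq br t).

Definition maker_wins (W : {fset T} -> Prop) (mk : nat -> T) : Prop :=
  exists t L, W L /\ {subset L <= mkseq mk t}.

Definition forces_draw (W : {fset T} -> Prop) (s : strategy) : Prop :=
  legal_strategy s /\
  forall mk br, play_against s mk br -> ~ maker_wins W mk.

End Game.

(* Main.v *)
Require Import Defs.
From mathcomp Require Import all_boot all_order all_algebra all_fingroup finmap zify ring.

(** Fix a linear form [f] from Z^d to F_p with [f (v i) != 0] for all [i]; it
    exists because fewer than p hyperplanes do not cover the dual of F_p^d.
    If residues [c i] are such that the [2n] elements [c i] and
    [c i + f (v i)] are distinct, then matching [x] with [x + v i] whenever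
    [f x = c i] is a pairing, and it meets every line of [p + 1] points, since
    [f] takes all values on the first [p] of them.

    The [c i] exist by the polynomial method.  Consider the product over
    [i < j] of the four factors [X_i - X_j + const] that must not vanish.
    Summing it over the grid {0, ..., 2n-2}^n against the weights of the
    [(2n-2)]-th finite difference in each variable only sees its part of top
    degree [n(2n-2)], so the constants may be replaced by [1, 0, -1, -2].  The
    new product vanishes on the grid except at [X_i = 2i], hence the sum is not
    zero, and the original product is nonzero somewhere. *)

Set Implicit Arguments.
Unset Strict Implicit.
Unset Printing Implicit Defensive.

Import Order.TTheory GRing.Theory Num.Theory.
Local Open Scope ring_scope.

(** * Finite differences and sums over a grid *)

(** An [N]-th finite difference kills degrees below [N]. One factor [a] turns ['C(N, a)] into [N]
    times ['C(N - 1, a - 1)]; reindexing then shifts [t] by 1, hence the general [t]. *)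
Lemma sum_alt_bin_expr (R : comNzRingType) (N e : nat) (t : R) : (e < N)%N ->
  \sum_(a < N.+1) (-1) ^+ a * 'C(N, a)%:R * (a%:R + t) ^+ e = 0.
Proof.
elim: e N t => [|e IHe] [|N] // t ltN.
  transitivity ((1 - 1 : R) ^+ N.+1); last by rewrite subrr expr0n.
  rewrite exprBn; apply: eq_bigr => a _.
  by rewrite expr0 !expr1n !mulr1 mulr_natr.
under eq_bigr do rewrite exprS mulrDl mulrDr [_ * (t * _)]mulrCA.
rewrite big_split -mulr_sumr /= IHe 1?ltnW // mulr0 addr0.
rewrite big_ord_recl mul0r mulr0 add0r.
transitivity (- N.+1%:R * \sum_(a < N.+1)
    (-1) ^+ a * 'C(N, a)%:R * (a%:R + (1 + t)) ^+ e); last by rewrite IHe ?mulr0.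
rewrite mulr_sumr; apply: eq_bigr => a _; rewrite lift0.
rewrite addrA -natr1 -!mulrA [_%:R * (_ * _)]mulrA natr1 -natrM mulnC.
rewrite -mul_bin_diag natrM exprS.
by ring.
Qed.

Lemma sum_bump (I : finType) (e : I -> nat) (j : I) :
  (\sum_i (e i + (i == j)) = (\sum_i e i).+1)%N.
Proof.
rewrite big_split /= [X in (_ + X)%N](bigD1 j) //= eqxx.
by rewrite [X in (1 + X)%N]big1 ?addn1 // => i /negPf->.
Qed.

Section GridFunctional.

Variables (F : comNzRingType) (I A : finType) (w pt : A -> F) (N : nat).
Hypothesis w_moment : forall e, (e < N)%N -> \sum_a w a * pt a ^+ e = 0.

Variables (K : Type) (i0 i1 : K -> I).

(** The exponents [e] record the monomial picked from factors already expanded, so that induction on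
    [s] goes through. *)
Definition grid_sum (c : K -> F) (e : I -> nat) (s : seq K) : F :=
  \sum_(x : {ffun I -> A}) (\prod_i (w (x i) * pt (x i) ^+ e i)) *
    \prod_(k <- s) (pt (x (i0 k)) - pt (x (i1 k)) + c k).

Lemma grid_sum_cons c e k s :
  grid_sum c e (k :: s) = grid_sum c (fun i => e i + (i == i0 k))%N s
    - grid_sum c (fun i => e i + (i == i1 k))%N s + c k * grid_sum c e s.
Proof.
have expD (x : {ffun I -> A}) j :
    \prod_i (w (x i) * pt (x i) ^+ (e i + (i == j))) =
    \prod_i (w (x i) * pt (x i) ^+ e i) * pt (x j).
  under eq_bigr do rewrite exprD mulrA.
  rewrite big_split /= [X in _ * X](bigD1 j) //= eqxx [\prod_(i | i != j) _]big1 ?mulr1 // => i.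
  by move/negPf->.
rewrite /grid_sum mulr_sumr -sumrB -big_split; apply: eq_bigr => x _ /=.
by rewrite big_cons !expD; ring.
Qed.

(** Once all factors are expanded, some variable has exponent below [N], and its moment vanishes. *)
Lemma grid_sum_low c e s :
  (\sum_i e i + size s < #|I| * N)%N -> grid_sum c e s = 0.
Proof.
elim: s e => [|k s IHs] e ltN.
  rewrite /grid_sum; under eq_bigr do rewrite big_nil mulr1.
  rewrite -(bigA_distr_bigA (fun i a => w a * pt a ^+ e i)).
  have [i lti|leN] := pickP (fun i => e i < N)%N.
    by rewrite (bigD1 i) //= w_moment ?mul0r.
  move: ltN; rewrite addn0 ltnNge -sum_nat_const leq_sum // => i _.
  by rewrite leqNgt leN.
rewrite /= addnS in ltN; rewrite grid_sum_cons !IHs ?mulr0 ?subrr ?addr0 //.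
- exact: ltnW.
all: by rewrite sum_bump.
Qed.

(** Picking the constant of a factor loses one degree, so that term falls under [grid_sum_low]. *)
Lemma grid_sum_top c c' e s :
  (\sum_i e i + size s <= #|I| * N)%N -> grid_sum c e s = grid_sum c' e s.
Proof.
elim: s e => [|k s IHs] e leN; first by apply: eq_bigr => x _; rewrite !big_nil.
rewrite /= addnS in leN.
rewrite !grid_sum_cons !(@grid_sum_low _ e) // !mulr0 !addr0.
by congr (_ - _); apply: IHs; rewrite sum_bump.
Qed.

End GridFunctional.

(** * Uniqueness of the surviving grid point *)

Lemma arith_squeeze (s n : nat) (X : nat -> nat) :
  (forall k, (k < n)%N -> (X k + s <= X k.+1)%N) -> (X n <= s * n)%N ->
  forall k, (k <= n)%N -> X k = (s * k)%N.
Proof.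
move=> stepX Xn.
have low k : (k <= n)%N -> (s * k <= X k)%N.
  elim: k => [|k IHk] lekn; first by rewrite muln0.
  by have := stepX k lekn; have := IHk (ltnW lekn); lia.
have high k : (k <= n)%N -> (X (n - k) + s * k <= X n)%N.
  elim: k => [|k IHk] lekn; first by rewrite subn0; lia.
  have := stepX (n - k.+1)%N; rewrite -subSn // subSS; have := IHk (ltnW lekn); lia.
move=> k lekn; have := low k lekn; have := high (n - k)%N (leq_subr _ _).
rewrite subKn //; nia.
Qed.

(** Values are pairwise at least 2 apart, so their halves form a permutation; sorting by [u], the
    bound [n.*2] forces the values 0, 2, 4 and so on. A gap of exactly 2 is allowed only upwards in
    the index, so [u] increases and is the identity. *)
Lemma spread_unique (n : nat) (x : 'I_n.+1 -> nat) :
  (forall i, x i <= n.*2)%N ->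
  (forall i j : 'I_n.+1, (i < j)%N -> (x i + 1 < x j)%N || (x j + 2 < x i)%N) ->
  forall i, x i = i.*2.
Proof.
move=> x_le x_far.
have far i j : i != j -> (x i + 1 < x j)%N || (x j + 1 < x i)%N.
  rewrite -(inj_eq val_inj) neq_ltn /= => /orP[] /x_far; lia.
have h_lt i : ((x i)./2 < n.+1)%N by have := x_le i; lia.
pose h i := Ordinal (h_lt i).
have h_inj : injective h.
  move=> i j /(congr1 val)/= eq_h; apply/eqP; apply: contraT => /far.
  by move: eq_h; lia.
pose u (k : nat) : 'I_n.+1 := (perm h_inj)^-1%g (inord k).
have hu k : (k < n.+1)%N -> (x (u k))./2 = k.
  move=> ltk; have /(congr1 val) := permKV (perm h_inj) (inord k).
  by rewrite permE /= inordK.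
have xu k : (k <= n)%N -> x (u k) = (2 * k)%N.
  apply: (@arith_squeeze 2 n (fun k => x (u k))) => [{}k ltk|]; last first.
    by have := x_le (u n); lia.
  have := hu k (ltnW ltk); have := hu k.+1 ltk.
  have: u k != u k.+1.
    by apply/eqP=> eq_u; have := hu k.+1 ltk; rewrite -eq_u hu; lia.
  by move/far; lia.
have uE k : (k <= n)%N -> u k = k :> nat.
  rewrite -[RHS]mul1n; apply: (@arith_squeeze 1 n (fun k => u k)) => [{}k ltk|].
    have := xu k (ltnW ltk); have := xu k.+1 ltk.
    have [| /x_far | /val_inj ->] := ltngtP (u k) (u k.+1); lia.
  by have := ltn_ord (u n); lia.
move=> i; have leN := leq_ord i.
have eq_ui : u i = i by apply: val_inj; exact: uE.
by rewrite -{1}eq_ui xu // mul2n.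
Qed.

(** * Seating couples by the polynomial method *)

Lemma natr_bin_neq0 (F : fieldType) (N a : nat) :
  (forall k, (0 < k <= N)%N -> k%:R != 0 :> F) -> (a <= N)%N ->
  'C(N, a)%:R != 0 :> F.
Proof.
move=> charF leaN.
have factF M : (M <= N)%N -> M`!%:R != 0 :> F.
  elim: M => [|M IHM] ltMN; first by rewrite fact0 oner_eq0.
  by rewrite factS natrM mulf_neq0 ?IHM ?(ltnW ltMN) // charF.
have := factF N (leqnn N); rewrite -(bin_fact leaN) natrM mulf_eq0 negb_or.
by case/andP.
Qed.

Lemma card_ltn_pairs (n : nat) :
  #|[pred q : 'I_n * 'I_n | (q.1 < q.2)%N]| = 'C(n, 2).
Proof.
rewrite -sum1_card (eq_bigl (fun q : 'I_n * 'I_n => (q.1 < q.2)%N)) //.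
rewrite -(pair_big_dep xpredT (fun i j : 'I_n => (i < j)%N) (fun _ _ => 1%N)) /=.
rewrite (exchange_big_dep xpredT) //= -bin2_sum big_mkord.
apply: eq_bigr => j _; rewrite (big_ord_narrow (ltnW (ltn_ord j))).
by rewrite sum1_card card_ord.
Qed.

(* The theorem of Preissmann and Mischler on seating couples at prescribed
   distances around a table with a prime number of seats. *)
Lemma seating_couples (F : fieldType) (n : nat) (d : 'I_n -> F) :
  (forall k, (0 < k <= n.*2)%N -> k%:R != 0 :> F) -> (forall i, d i != 0) ->
  exists c : 'I_n -> F,
    injective (fun q : 'I_n * bool => c q.1 + d q.1 *+ q.2).
Proof.
case: n d => [|n] d charF d_neq0.
  by exists (fun=> 0); case=> -[].
(* There are now [n.+1] couples, so twice their number minus 2 is [n.*2]. *)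
pose N := n.*2; pose K : finType := (('I_n.+1 * 'I_n.+1) * (bool * bool))%type.
pose w (a : 'I_N.+1) : F := (-1) ^+ a * 'C(N, a)%:R.
pose pt (a : 'I_N.+1) : F := a%:R.
pose i0 (k : K) : 'I_n.+1 := k.1.1; pose i1 (k : K) : 'I_n.+1 := k.1.2.
pose cd (k : K) := d (i0 k) *+ k.2.1 - d (i1 k) *+ k.2.2.
(* The values 1, 0, -1, -2: exactly the differences [x j - x i] excluded in [spread_unique]. *)
pose c0 (k : K) : F := 1 - (k.2.1.*2 + k.2.2)%:R.
pose s := [seq k <- enum K | (i0 k < i1 k)%N].
pose factors c (x : {ffun 'I_n.+1 -> 'I_N.+1}) :=
  \prod_(k <- s) (pt (x (i0 k)) - pt (x (i1 k)) + c k).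
have factorsP c (x : {ffun 'I_n.+1 -> 'I_N.+1}) : reflect
    (forall k, (i0 k < i1 k)%N -> pt (x (i0 k)) - pt (x (i1 k)) + c k != 0)
    (factors c x != 0).
  by rewrite /factors big_filter big_enum_cond; apply: (iffP (prodf_neq0 _ _)).
have w_moment e : (e < N)%N -> \sum_a w a * pt a ^+ e = 0.
  move=> lteN; rewrite -[RHS](sum_alt_bin_expr (0 : F) lteN).
  by apply: eq_bigr => a _; rewrite addr0.
(* Four factors per pair give degree [4 * 'C(n.+1, 2) = n.+1 * N], just within reach of
   [grid_sum_top]. *)
have size_s : (\sum_(i < n.+1) 0 + size s <= #|'I_n.+1| * N)%N.
  have -> : size s = (#|[pred q : 'I_n.+1 * 'I_n.+1 | (q.1 < q.2)%N]| * 4)%N.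
    rewrite -sum1_size big_filter big_enum_cond sum1dep_card.
    rewrite -[4%N]/(2 * 2)%N -card_bool -card_prod -cardX.
    by apply: eq_card => k; rewrite !inE andbT.
  rewrite big1 // card_ltn_pairs card_ord bin2; rewrite /N /=; lia.
have sumE : grid_sum w pt i0 i1 cd (fun=> 0%N) s =
    grid_sum w pt i0 i1 c0 (fun=> 0%N) s by exact: (grid_sum_top w_moment).
have x0_lt (i : 'I_n.+1) : (i.*2 < N.+1)%N by rewrite /N; have := ltn_ord i; lia.
pose x0 := [ffun i => Ordinal (x0_lt i)].
have factors_x0 : factors c0 x0 != 0.
  apply/factorsP => -[[i j] [b1 b2]]; rewrite /i0 /i1 /pt /c0 !ffunE /= => ltij.
  (* Up to sign, the factor is an integer between 1 and [n.+1.*2], the range covered by [charF]. *)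
  have -> : i.*2%:R - j.*2%:R + (1 - (b1.*2 + b2)%:R) =
      - (j.*2 + b1.*2 + b2 - i.*2 - 1)%:R :> F.
    have -> : j.*2%:R = (j.*2 + b1.*2 + b2 - i.*2 - 1)%:R
        + i.*2%:R + 1 - (b1.*2 + b2)%:R :> F.
      apply/eqP; rewrite eq_sym subr_eq -natrD natr1 -natrD; apply/eqP; congr _%:R.
      by case: b1 b2 => -[] /=; lia.
    by ring.
  by rewrite oppr_eq0 charF //; have := ltn_ord j; case: b1 b2 => -[] /=; lia.
have factors_c0 x : x != x0 -> factors c0 x = 0.
  apply: contraNeq => /factorsP far_x; apply/eqP/ffunP => i; apply: val_inj.
  rewrite ffunE /=; apply: (@spread_unique n (fun i => x i)) => [{}i|{}i j ltij].
    exact: leq_ord.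
  (* An equality of naturals would persist in [F] and make a factor vanish. *)
  have far (b1 b2 : bool) : (x i + 1 != x j + (b1.*2 + b2))%N.
    have := far_x ((i, j), (b1, b2)) ltij; apply: contra => /eqP/(congr1 (fun k => k%:R : F)).
    by rewrite /pt /c0 /= !natrD => eqx; rewrite addrACA eqx -opprD subrr.
  have := (far false false, far false true, far true false, far true true).
  by case=> -[[]] /=; lia.
have : grid_sum w pt i0 i1 cd (fun=> 0%N) s != 0.
  rewrite sumE /grid_sum (bigD1 x0) //= [X in _ + X]big1 => [|x /factors_c0]; last first.
    by rewrite /factors => ->; rewrite mulr0.
  rewrite addr0 mulf_neq0 //; apply/prodf_neq0 => i _.
  rewrite mulr1 mulf_neq0 ?signr_eq0 // natr_bin_neq0 ?leq_ord // => k /andP[k_gt0 lekN].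
  by rewrite charF // k_gt0; move: lekN; rewrite /N; lia.
have [x /factorsP nz_x _|factors0] := pickP (fun x => factors cd x != 0); last first.
  rewrite /grid_sum big1 ?eqxx // => x _.
  by have /negbFE/eqP := factors0 x; rewrite /factors => ->; rewrite mulr0.
have neq_seats (i j : 'I_n.+1) (b1 b2 : bool) : (i < j)%N ->
    pt (x i) + d i *+ b1 != pt (x j) + d j *+ b2.
  move=> ltij; have := nz_x ((i, j), (b1, b2)) ltij; apply: contra => /eqP eqx.
  by rewrite /cd /i0 /i1 /= addrACA eqx -opprD subrr.
exists (fun i => pt (x i)) => -[i a] [j b] /= eq_ij.
have [ltij | ltji | /val_inj eq_ij0] := ltngtP i j.
- by have := neq_seats i j a b ltij; rewrite eq_ij eqxx.
- by have := neq_seats j i b a ltji; rewrite eq_ij eqxx.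
rewrite -{j}eq_ij0 in eq_ij *; congr (_, _).
move/addrI: eq_ij; case: a b => -[] //= /eqP; rewrite ?mulr0n ?mulr1n.
  by rewrite (negPf (d_neq0 i)).
by rewrite eq_sym (negPf (d_neq0 i)).
Qed.

(** * Drawing strategies from involutions *)

Section PairingStrategy.

Variables (T : choiceType) (g : T -> T) (fresh : seq T -> T) (x0 : T).
Hypothesis gK : involutive g.
Hypothesis freshP : forall s, fresh s \notin s.

Definition moved_pairs (e : {fset T}) : Prop :=
  exists2 x, g x != x & e = [fset x; g x]%fset.

Lemma moved_pairs_matching : matching moved_pairs.
Proof.
split=> [e [x gx ->]|e f [x gx ->] [y gy ->] neq_ef].
  by rewrite cardfs2 eq_sym gx.
apply/fdisjointP => z; rewrite !inE => /orP zx.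
have eq_x : [fset x; g x]%fset = [fset z; g z]%fset.
  by case: zx => /eqP->; rewrite // gK fsetUC.
apply: contra_notN neq_ef => /orP zy; rewrite eq_x.
by case: zy => /eqP->; rewrite // gK fsetUC.
Qed.

Definition pairing_strategy : strategy T := fun A B =>
  let y := g (last x0 A) in if y \notin A ++ B then y else fresh (A ++ B).

Lemma pairing_strategy_legal : legal_strategy pairing_strategy.
Proof. by move=> A B; rewrite /pairing_strategy; case: ifP. Qed.

Lemma pairing_strategy_plays : plays_pairing moved_pairs pairing_strategy.
Proof.
move=> A B x y neq_xy [z gz eq_z] freey; rewrite /pairing_strategy last_rcons.
suff -> : g x = y by rewrite freey.
move/fsetP in eq_z; have := eq_z x; have := eq_z y; rewrite !inE !eqxx orbT /=.
move=> /esym/orP[]/eqP ey /esym/orP[]/eqP ex; rewrite ?ex ?ey ?gK //;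
  by rewrite ex ey eqxx in neq_xy.
Qed.

(** If Maker held a whole pair, the point he took later was still free when he took the other one,
    so Breaker answered with it at once. *)
Lemma pairing_strategy_draw (W : {fset T} -> Prop) :
  blocks moved_pairs W -> forces_draw W pairing_strategy.
Proof.
move=> blocksW; split=> [|mk br play [t [L [WL sLt]]]].
  exact: pairing_strategy_legal.
have [_ [x gx ->] /fsubsetP sxL] := blocksW L WL.
have /sLt/mapP[a _ mka] : x \in L by rewrite sxL // !inE eqxx.
have /sLt/mapP[b _ mkb] : g x \in L by rewrite sxL // !inE eqxx orbT.
have no_answer a' b' : (a' < b')%N -> mk b' = g (mk a') -> False.
  move=> ltab mkb'; have [freeb _] := play b'; have [_ bra] := play a'.
  have later (h : nat -> T) k : (k <= b')%N -> {subset mkseq h k <= mkseq h b'}.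
    move=> lekb y /mapP[c]; rewrite mem_iota => ltck ->.
    by apply: map_f; rewrite mem_iota (leq_trans _ lekb).
  have free : g (mk a') \notin mkseq mk a'.+1 ++ mkseq br a'.
    rewrite -mkb'; apply: contra freeb; rewrite !mem_cat.
    by case/orP => /later ->; rewrite ?orbT // ltnW.
  have eq_last : last x0 (mkseq mk a'.+1) = mk a' by rewrite mkseqS last_rcons.
  move/negP: freeb; apply; rewrite mem_cat mkb'.
  move: bra; rewrite /pairing_strategy eq_last free => <-.
  by rewrite map_f ?orbT // mem_iota.
have [ltab | ltba | eqab] := ltngtP a b.
- by apply: (no_answer a b) => //; rewrite -mka -mkb.
- by apply: (no_answer b a) => //; rewrite -mka -mkb gK.
- by move: gx; rewrite mkb -eqab -mka eqxx.
Qed.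

End PairingStrategy.

(** * Linear forms nonzero on given vectors *)

(** A form good for [s] is corrected along one coordinate [j] with [v i j != 0]. Each vector rules
    out at most one correction [t], so fewer than [#|F|] are lost. *)
Lemma separating_functional (F : finFieldType) (I : eqType) (J : finType)
    (s : seq I) (v : I -> J -> F) :
  (size s < #|F|)%N -> (forall i, i \in s -> exists j, v i j != 0) ->
  exists r : J -> F, forall i, i \in s -> \sum_j v i j * r j != 0.
Proof.
elim: s => [|i s IHs] lts v_neq0; first by exists (fun=> 0).
have [||r r_neq0] := IHs; first exact: ltnW.
  by move=> k ks; apply: v_neq0; rewrite inE ks orbT.
have [j vij] := v_neq0 i (mem_head i s).
pose phi k := \sum_l v k l * r l.
(* When [v k j = 0] the quotient is 0 by convention: one more value is avoided, within the same
   count. *)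
have [t t_good] : exists t, t \notin [seq - phi k / v k j | k <- i :: s].
  apply/existsP; rewrite -negb_forall; apply: contraL lts => /forallP all_t.
  rewrite -leqNgt -(size_map (fun k => - phi k / v k j)).
  apply: leq_trans (card_size _); apply: subset_leq_card.
  by apply/subsetP=> t _; exact: all_t.
exists (fun l => r l + t *+ (l == j)) => k ks.
have -> : \sum_l v k l * (r l + t *+ (l == j)) = phi k + v k j * t.
  under eq_bigr do rewrite mulrDr.
  rewrite big_split /= [X in _ + X](bigD1 j) //= eqxx mulr1n.
  by rewrite [\sum_(i | i != j) _]big1 ?addr0 // => l /negPf->; rewrite mulr0n mulr0.
have [vkj0|vkj] := eqVneq (v k j) 0.
  rewrite vkj0 mul0r addr0; apply: r_neq0; move: ks; rewrite inE => /orP[/eqP ki|//].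
  by rewrite -ki vkj0 eqxx in vij.
apply: contraNneq t_good => /eqP; rewrite addrC addr_eq0 => /eqP eqt.
by apply/mapP; exists k; rewrite // -eqt mulrC mulKf.
Qed.

Lemma primitive_not_dvd (d p : nat) (w : 'rV[int]_d) : (1 < p)%N ->
  primitive w -> exists j, ~~ (p %| (w 0 j)%R)%Z.
Proof.
move=> p_gt1 w_prim; apply/existsP; rewrite -negb_forall; apply/negP => /forallP dvd_w.
have : (p %| 1%R)%Z.
  rewrite -w_prim; elim/big_ind: _ => [||j _]; rewrite ?dvdz0 // => x y.
  by rewrite dvdz_gcd => ->.
by rewrite dvdz1 /=; lia.
Qed.

(** * The pairing of the lattice *)

Theorem theorem2 (d n m : nat) (v : 'I_n -> 'rV[int]_d)
  (hd : (1 <= d)%N) (hn : (1 <= n)%N)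
  (hv : forall i : 'I_n, primitive (v i))
  (hp : prime (m - 1)) (hm : (2 * n + 1 <= m - 1)%N) :
  exists M : {fset 'rV[int]_d} -> Prop,
    [/\ matching M,
        blocks M (winning_set m v)
      & exists s : strategy 'rV[int]_d,
          plays_pairing M s /\ forces_draw (winning_set m v) s].
Proof.
set p := (m - 1)%N in hp hm.
have p_gt1 : (1 < p)%N by lia.
have charp := pchar_Fp hp.
have cardFp : #|'F_p| = p by rewrite card_ord Fp_cast.
have [r r_neq0] : exists r : 'I_d -> 'F_p,
    forall i, i \in enum 'I_n -> \sum_j (v i 0 j)%:~R * r j != 0.
  apply: (separating_functional (v := fun i j => (v i 0 j)%:~R)) => [|i _].
    by rewrite cardFp size_enum_ord; lia.
  have [j] := primitive_not_dvd p_gt1 (hv i).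
  by rewrite (dvdz_pcharf charp); exists j.
pose f (x : 'rV[int]_d) : 'F_p := \sum_j (x 0 j)%:~R * r j.
have f_add a w : f (a + w) = f a + f w.
  by rewrite -big_split; apply: eq_bigr => j _; rewrite mxE intrD mulrDl.
have f_muln w k : f (w *+ k) = f w *+ k.
  elim: k => [|k IHk]; last by rewrite !mulrS f_add IHk.
  by rewrite /f big1 // => j _; rewrite mxE mul0r.
have fv_neq0 i : f (v i) != 0 by rewrite r_neq0 // mem_enum.
have charF k : (0 < k <= n.*2)%N -> k%:R != 0 :> 'F_p.
  case/andP=> k_gt0 lek; rewrite -(dvdn_pcharf charp); apply: contraL lek.
  by move/(dvdn_leq k_gt0); lia.
have [c c_inj] := seating_couples charF fv_neq0.
pose seat (q : 'I_n * bool) := c q.1 + f (v q.1) *+ q.2.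
(* Residue [c i] moves forward by [v i], residue [c i + f (v i)] moves back, all others stay;
   [c_inj] makes the choice unambiguous. *)
pose g (x : 'rV[int]_d) : 'rV[int]_d :=
  if [pick q | f x == seat q] is Some (i, b)
  then if b then x - v i else x + v i else x.
have gE x i b : f x = seat (i, b) -> g x = if b then x - v i else x + v i.
  move=> fx; rewrite /g; case: pickP => [q|/(_ (i, b))]; last by rewrite fx eqxx.
  by rewrite fx => /eqP/c_inj <-.
have gK : involutive g.
  move=> x; case: (pickP (fun q => f x == seat q)) => [[i b] /eqP fx|noq].
    rewrite (gE _ _ _ fx); case: b fx => fx.
      rewrite (gE _ i false) ?subrK //.
      by apply: (addIr (f (v i))); rewrite -f_add subrK fx /seat /= addr0.
    by rewrite (gE _ i true) ?addrK // f_add fx /seat /= addr0.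
  have gx : g x = x by rewrite /g; case: pickP => // q; rewrite noq.
  by rewrite !gx.
(* Its first coordinate exceeds that of every point of [s]. *)
pose fresh (s : seq 'rV[int]_d) : 'rV[int]_d :=
  const_mx (1 + \sum_(x <- s) `|x 0 (Ordinal hd)|).
have freshP s : fresh s \notin s.
  apply/negP => fresh_s.
  have : fresh s 0 (Ordinal hd) <= \sum_(x <- s) `|x 0 (Ordinal hd)|.
    apply: le_trans (ler_norm _) _.
    by rewrite (big_rem _ fresh_s) /= lerDl sumr_ge0.
  by rewrite mxE gerDr ler10.
have blocked : blocks (moved_pairs g) (winning_set m v).
  move=> _ [a [i ->]].
  (* The solution of [f a + k * f (v i) = c i] in ['F_p]. Its representative is below [p = m - 1],
     so the partner at index [k + 1] is still on the line. *)
  pose k := nat_of_ord ((c i - f a) / f (v i)).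
  have lt_kp : (k < p)%N by apply: leq_trans (ltn_ord _) _; rewrite Fp_cast.
  pose x := a + v i *+ k.
  have fx : f x = seat (i, false).
    rewrite /x f_add f_muln -mulr_natr natr_Zp mulrC divfK //.
    by rewrite /seat addr0 addrC subrK.
  have gx : g x = x + v i by rewrite (gE _ _ _ fx).
  have v_neq0 : v i != 0.
    by apply: contraNneq (fv_neq0 i) => ->; rewrite -(mulr0n 0) f_muln.
  exists [fset x; g x]%fset.
    by exists x; rewrite // gx -subr_eq0 addrAC subrr add0r.
  have on_line l : (l < m)%N -> a + v i *+ l \in line m a (v i).
    by move=> ltl; apply/imfsetP; exists (Ordinal ltl).
  apply/fsubsetP => y; rewrite !inE => /orP[]/eqP->.
    by apply: on_line; lia.
  by rewrite gx /x -addrA -mulrSr on_line //; lia.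
exists (moved_pairs g); split=> //; first exact: moved_pairs_matching.
exists (pairing_strategy g fresh 0); split; first exact: pairing_strategy_plays.
exact: pairing_strategy_draw.
Qed.
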